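(* There exists a large enough absolute constant $c$ such that the following holds. Let $0<\epsilon<1-3\frac{\log 24}{\log n}$ and let $P=Xor$ be the parity predicate on $k=t$ bits, $P(y)=\sum_{i=1}^k y^i\bmod 2$. Suppose an algorithm (read-once branching program) distinguishes between $D_{null}$ and $D_{planted}(x)$, for $x$ uniform on $\{0,1\}^n$, with success probability at least $\frac12+s$ and uses fewer than $n^{\epsilon}$ bits of memory. Then for $k\le n/c$, if $s>3\left(\frac nk\right)^{-\frac{1-\epsilon}{18}k}$, the algorithm requires $\left(\frac nk\right)^{\frac{1-\epsilon}{18}k}$ samples.
   Context: Logarithms are base 2. $[n]^{(k)}$ is the set of ordered $k$-tuples of distinct elements of $[n]=\{1,\dots,n\}$; for $a\in[n]^{(k)}$, $a^i$ is its $i$-th entry, and for $x\in\{0,1\}^n$, $x^a\in\{0,1\}^k$ is given by $(x^a)^i=x^{a^i}$. $D_{null}$: $a$ uniform in $[n]^{(k)}$ and $b$ an independent uniform bit; $D_{planted}(x)$: $a$ uniform in $[n]^{(k)}$ and $b=P(x^a)$. A distinguisher is a branching program: a layered directed multigraph with $m+1$ layers of at most $d$ vertices, a single start vertex in layer 0, each non-leaf vertex having one outgoing edge to the next layer for each sample value $(a,b)\in[n]^{(k)}\times\{0,1\}$, leaves labeled by outputs ``null'' (0) or ``planted'' (1); memory $b$ means width $2^b$ and the number of samples is the length $m$. Its success probability is $$\frac{\Pr_{u_1,\dots,u_m\sim D_{null}}[L=\text{null}]+\Pr_{x\in_R\{0,1\}^n;\,u_1,\dots,u_m\sim D_{planted}(x)}[L=\text{planted}]}{2},$$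 samples drawn independently. *)

(* Defs.v *)
From HB Require Import structures.
From mathcomp Require Import all_boot all_order all_algebra.
From mathcomp Require Import reals exp.

Set Implicit Arguments.
Unset Strict Implicit.
Unset Printing Implicit Defensive.
Import Order.TTheory GRing.Theory Num.Theory.
Local Open Scope ring_scope.

Definition log2 (R : realType) (x : R) : R := ln x / ln 2.

(* [n]^(k): ordered k-tuples of distinct indices (indices start at 0). *)
Definition dtuple (n k : nat) : finType := {a : k.-tuple 'I_n | uniq a}.

Definition sample (n k : nat) : finType := (dtuple n k * bool)%type.

(* x^a, the bits of x at the positions listed in a. *)
Definition restrict (n k : nat) (x : n.-tuple bool) (a : dtuple n k) :
  k.-tuple bool := [tuple tnth x (tnth (val a) i) | i < k].

Definition Xor (k : nat) (y : k.-tuple bool) : bool :=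
  odd (\sum_(i < k) tnth y i)%N.

(* Probability mass functions of one sample. *)
Definition D_null (R : realType) (n k : nat) (u : sample n k) : R :=
  #|dtuple n k|%:R^-1 * 2^-1.

Definition D_planted (R : realType) (n k : nat) (P : k.-tuple bool -> bool)
    (x : n.-tuple bool) (u : sample n k) : R :=
  #|dtuple n k|%:R^-1 * (u.2 == P (restrict x u.1))%:R.

(* Probability of the event E under m independent draws from the mass
   function D. *)
Definition Pr_iid (R : realType) (S : finType) (m : nat) (D : S -> R)
    (E : pred (m.-tuple S)) : R :=
  \sum_(u : m.-tuple S | E u) \prod_(i < m) D (tnth u i).

(* Branching programs of length m and width at most d reading samples in S.
   Vertices are sorted into layers 0..m.  [out v] is either a label, making v
   a leaf (false stands for "null", true for "planted"), or the targets of the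
   outgoing edges of v, one for each sample value.  All vertices of the last
   layer are leaves; earlier layers may contain leaves too. *)
Record branching_program (S : finType) (m d : nat) := BranchingProgram {
  vertex :> finType;
  layer : vertex -> nat;
  start : vertex;
  out : vertex -> bool + (S -> vertex);
  layer_max : forall v, (layer v <= m)%N;
  layer_start : forall v, layer v = 0%N <-> v = start;
  layer_out : forall v next, out v = inr next ->
    forall u, layer (next u) = (layer v).+1;
  leaf_last : forall v, layer v = m -> exists l, out v = inl l;
  width_max : forall i : nat, (#|[set v | layer v == i]| <= d)%N
}.

(* The label of the leaf reached from v by following the samples us; samples
   left over once a leaf is reached are ignored. *)
Fixpoint bp_run (S : finType) (m d : nat) (B : branching_program S m d)
    (v : B) (us : seq S) {struct us} : option bool :=
  match out v with
  | inl l => Some l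
  | inr next => if us is u :: us' then bp_run (next u) us' else None
  end.

Definition bp_output (S : finType) (m d : nat) (B : branching_program S m d)
    (u : m.-tuple S) : option bool := bp_run (start B) u.

(* The value None is never taken on a full input. *)
Lemma bp_outputP (S : finType) (m d : nat) (B : branching_program S m d)
    (u : m.-tuple S) : bp_output B u <> None.
Proof.
have H : forall (us : seq S) (v : B),
  (layer v + size us)%N = m -> bp_run v us <> None.
  elim=> [|s us IH] v /= Hv.
    by rewrite addn0 in Hv; have [l ->] := leaf_last Hv.
  case E: (out v) => [l|next] //.
  by apply: IH; rewrite (layer_out E) addSnnS.
apply: H; rewrite size_tuple.
by have /= -> := proj2 (layer_start (start B)) erefl.
Qed.

(* Width d corresponds to log2 d bits of memory. *)
Definition memory (R : realType) (d : nat) : R := log2 d%:R.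

Definition success_prob (R : realType) (n k m d : nat)
    (P : k.-tuple bool -> bool) (B : branching_program (sample n k) m d) : R :=
  (Pr_iid (@D_null R n k) (fun u : m.-tuple _ => bp_output B u == Some false)
   + (2 ^+ n)^-1 * \sum_(x : n.-tuple bool)
       Pr_iid (D_planted R P x)
         (fun u : m.-tuple _ => bp_output B u == Some true)) / 2.

(* Main.v *)
Require Import Defs.
From mathcomp Require Import all_boot all_order all_algebra.
From mathcomp Require Import reals exp.
From mathcomp Require Import ring lra.
Import Order.TTheory GRing.Theory Num.Theory.
Local Open Scope ring_scope.

(* Hybrid argument: replace the planted samples by null ones one at a time, the
   last ones first.  A vertex v of layer i carries a weight mu_v on {0,1}^n with
   mu_v <= 2^-n (the joint law of x and "v is reached after i planted samples"),
   and exchanging one sample there changes the acceptance probability by at most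
   half of E_a |F_v(a)|, where F_v(a) = sum_x mu_v(x) (-1)^(parity of x^a).

   By Cauchy-Schwarz, and passing from distinct to arbitrary k-tuples of indices
   at the cost of a factor 2^k, (E_a |F_v(a)|)^2 is at most
   (2/n)^k sum_(x, y) mu_v(x) mu_v(y) T(x,y)^k with
   T(x,y) = sum_i (-1)^(x_i + y_i).  For tau = 2 sqrt(2rn) and 2r >= k one has
   T^k <= tau^k (1 + (T/tau)^(2r)), and since mu_v(y) <= 2^-n the last term is
   controlled by the moment E_y T(x,y)^(2r) <= (2rn)^r of a random walk.  Hence
   E_a |F_v(a)| <= w^k (|mu_v| + 4^-r) with w^4 = 32r/n, and if the width is at
   most 4^r, summing over a layer bounds the advantage per sample by w^k. *)

(** * Even moments of a signed random walk *)

Lemma big_tuple_cons (R : nmodType) (S : finType) (n : nat)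
    (f : n.+1.-tuple S -> R) :
  \sum_(u : n.+1.-tuple S) f u =
  \sum_(a : S) \sum_(u : n.-tuple S) f [tuple of a :: u].
Proof.
rewrite pair_big /=.
rewrite (reindex (fun p : S * n.-tuple S => [tuple of p.1 :: p.2])) //=.
exists (fun t : n.+1.-tuple S => (thead t, [tuple of behead t])).
  by move=> [a u] _ /=; congr pair; rewrite ?theadE //; apply: val_inj.
by move=> t _ /=; rewrite [RHS]tuple_eta.
Qed.

(** By induction on [j]: passing to [j + 1] multiplies the left side by (2r-2j)(2r-2j-1) /
    ((2j+2)(2j+1)) and the right side by (2r-2j) 2r / (2j+2), and 2r-2j-1 is at most 2r(2j+1). *)
Lemma bin_double_le (r j : nat) :
  ('C(r.*2, j.*2) <= 'C(r, j) * r.*2 ^ j)%N.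
Proof.
elim: j => [|j IH]; first by rewrite !bin0.
case: (leqP r j) => [lerj|ltjr].
  by rewrite bin_small // ltn_double.
rewrite doubleS.
have E1 := mul_bin_left r.*2 j.*2.
have E2 := mul_bin_left r.*2 j.*2.+1.
have E3 := mul_bin_left r j.
rewrite -(@leq_pmul2l (j.*2.+2 * j.*2.+1)) //.
have -> : (j.*2.+2 * j.*2.+1 * 'C(r.*2, j.*2.+2) =
  (r.*2 - j.*2.+1) * ((r.*2 - j.*2) * 'C(r.*2, j.*2)))%N.
  by rewrite -E1 mulnAC E2 -mulnA [in RHS]mulnCA [LHS]mulnC mulnCA mulnC
     mulnA [(j.*2.+1 * _)%N]mulnC mulnA.
have -> : (j.*2.+2 * j.*2.+1 * ('C(r, j.+1) * r.*2 ^ j.+1) =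
  (r.*2 * j.*2.+1) * ((r.*2 - j.*2) * ('C(r, j) * r.*2 ^ j)))%N.
  rewrite expnS -doubleS -doubleB -!muln2.
  have -> : ((j.+1 * 2) * (j * 2).+1 * ('C(r, j.+1) * (r * 2 * (r * 2) ^ j)) =
    (j.+1 * 'C(r, j.+1)) * (2 * (j * 2).+1 * (r * 2) * (r * 2)^j))%N.
    by ring.
  by rewrite E3; ring.
rewrite leq_mul // ?leq_mul //.
by rewrite (leq_trans (leq_subr _ _)) // leq_pmulr.
Qed.

Lemma sum_ord_odd_even (R : nmodType) (r : nat) (f : nat -> R) :
  \sum_(i < r.*2.+1) f i =
  \sum_(j < r.+1) f j.*2 + \sum_(j < r) f j.*2.+1.
Proof.
elim: r => [|r IH]; first by rewrite !big_ord_recl !big_ord0 !addr0.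
rewrite doubleS 2!big_ord_recr IH /= [X in _ = X + _]big_ord_recr /=.
rewrite [X in _ = _ + X]big_ord_recr /= -addrA.
by rewrite [X in _ + X = _]addrC addrACA.
Qed.

(** Averages an even power over one random sign: odd powers of [e] cancel and even ones equal 1. *)
Lemma even_binomial (R : comNzRingType) (r : nat) (A e : R) : e ^+ 2 = 1 ->
  (A + e) ^+ r.*2 + (A - e) ^+ r.*2 =
  2 * \sum_(j < r.+1) A ^+ (r - j).*2 *+ 'C(r.*2, j.*2).
Proof.
move=> e2; rewrite !exprDn -big_split /=.
rewrite (sum_ord_odd_even _ r (fun i => A ^+ (r.*2 - i) * e ^+ i *+ 'C(r.*2, i) +
  A ^+ (r.*2 - i) * (- e) ^+ i *+ 'C(r.*2, i))).
rewrite [X in _ + X]big1 ?addr0 => [|j _]; last first.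
  rewrite exprNn -signr_odd /= odd_double /= mulN1r mulrN mulNrn.
  by rewrite subrr.
rewrite mulr_sumr; apply: eq_bigr => j _.
have ej : e ^+ j.*2 = 1 by rewrite -mul2n exprM e2 expr1n.
rewrite exprNn -signr_odd odd_double ej !mulr1 -doubleB.
by rewrite mulr_natl mulr2n.
Qed.

(** Induction on [n], summing out the first sign with [even_binomial]. The resulting terms are
    compared one by one, through [bin_double_le], with the binomial expansion of (2rn + 2r)^r. *)
Lemma rademacher_moment (R : realFieldType) (n r : nat) (e : 'I_n -> R) :
  (forall i, e i ^+ 2 = 1) ->
  \sum_(y : n.-tuple bool) (\sum_(i < n) e i * (-1) ^+ tnth y i) ^+ r.*2
  <= 2 ^+ n * (r.*2 * n)%:R ^+ r.
Proof.
elim: n r e => [|n IH] r e He.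
  rewrite (eq_bigr (fun=> 0 ^+ r.*2)); last by move=> y _; rewrite big_ord0.
  rewrite sumr_const card_tuple expr0 mul1r muln0.
  by case: r => [|r]; rewrite ?expr0 // doubleS !expr0n.
rewrite big_tuple_cons big_bool /= -big_split /=.
pose A (y : n.-tuple bool) : R := \sum_(i < n) e (lift ord0 i) * (-1) ^+ tnth y i.
have E (b : bool) (y : n.-tuple bool) :
  \sum_(i < n.+1) e i * (-1) ^+ tnth [tuple of b :: y] i =
  A y + e ord0 * (-1) ^+ b.
  rewrite big_ord_recl addrC; congr (_ + _).
  by apply: eq_bigr => i _; rewrite tnthS.
under eq_bigr => y _ do rewrite !E expr1 expr0 mulrN1 mulr1 addrC even_binomial //.
rewrite -mulr_sumr exchange_big /= exprS -mulrA ler_pM2l //.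
have -> : ((r.*2 * n.+1)%:R : R) ^+ r =
  \sum_(j < r.+1) (r.*2 * n)%:R ^+ (r - j) * r.*2%:R ^+ j *+ 'C(r, j).
  by rewrite -exprDn mulnS natrD addrC.
rewrite mulr_sumr; apply: ler_sum => -[j /= ltjr] _.
rewrite sumrMnl.
apply: (@le_trans _ _ ((2 ^+ n * (r.*2 * n)%:R ^+ (r - j)) *+ 'C(r.*2, j.*2))).
  rewrite lerMn2r; apply/orP; right.
  (* The induction hypothesis at moment 2(r-j) gives base 2(r-j)n, which is enlarged to 2rn. *)
  apply: le_trans (IH _ _ (fun i => He _)) _.
  rewrite ler_pM2l ?exprn_gt0 // lerXn2r ?nnegrE // ler_nat.
  by rewrite leq_mul // leq_double leq_subr.
rewrite -mulrnAr -[X in _ <= _ * X]mulrnAr ler_pM2l ?exprn_gt0 //.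
rewrite -[X in X <= _]mulr_natr ler_wpM2l ?exprn_ge0 //.
by rewrite -natrX -mulrnA ler_nat mulnC bin_double_le.
Qed.

(** * Counting distinct tuples, and two elementary inequalities *)

Lemma card_dtuple (n k : nat) : #|dtuple n k| = (n ^_ k)%N.
Proof.
rewrite card_sig -[in RHS](card_ord n) -(card_uniq_tuples k predT) cardsE.
apply: eq_card => t; by rewrite !inE unfold_in /= all_predT.
Qed.

(** Each factor n - i of the falling factorial, with i < k, is at least n/2. *)
Lemma expn_le_ffact (n k : nat) : (k.*2 <= n)%N ->
  (n ^ k <= 2 ^ k * n ^_ k)%N.
Proof.
move=> le2kn; rewrite ffact_prod -[in (n ^ k)%N](card_ord k) -prod_nat_const.
rewrite -[in (2 ^ k)%N](card_ord k) -prod_nat_const -big_split /=.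
apply: leq_prod => i _; rewrite mulnBr leq_subRL; last first.
  rewrite leq_pmul2l //; apply: leq_trans (ltnW (ltn_ord i)) _.
  by apply: leq_trans le2kn; rewrite -addnn leq_addr.
rewrite (mul2n n) -(addnn n) leq_add2r mul2n; apply: leq_trans le2kn.
by rewrite leq_double ltnW.
Qed.

(** Cauchy-Schwarz against the constant 1, read off from the nonnegative sum of the (N f(i) -
    S)^2. *)
Lemma sqr_sum_le (R : realFieldType) (I : finType) (f : I -> R) :
  (\sum_i f i) ^+ 2 <= #|I|%:R * \sum_i f i ^+ 2.
Proof.
have [/card0_eq I0|I0] := posnP #|I|.
  by rewrite !big_pred0 ?mulr0 ?expr0n.
set N : R := #|I|%:R; set S := \sum_i f i.
have N0 : 0 < N by rewrite ltr0n.
have : 0 <= \sum_i (N * f i - S) ^+ 2 by apply: sumr_ge0 => i _; exact: sqr_ge0.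
under eq_bigr => i _ do rewrite sqrrB exprMn.
rewrite big_split sumrB /= sumr_const -/N -mulr_sumr.
rewrite -(mulr_natr (S ^+ 2)) -/N.
under [X in _ - X + _]eq_bigr => i _ do rewrite -mulrA [f i * S]mulrC mulrA -mulrnAl.
rewrite -mulr_sumr -/S.
set Q := \sum_i f i ^+ 2.
have -> : N ^+ 2 * Q - N * S *+ 2 * S + S ^+ 2 * N = N * (N * Q - S ^+ 2) by ring.
by rewrite pmulr_rge0 // subr_ge0.
Qed.

Lemma exprn_le1D (R : realDomainType) (u : R) (k m : nat) : (k <= m.*2)%N ->
  u ^+ k <= 1 + u ^+ m.*2.
Proof.
move=> lekm; apply: le_trans (ler_norm _) _; rewrite normrX.
have -> : u ^+ m.*2 = `|u| ^+ m.*2 by rewrite -!mul2n !exprM real_normK ?num_real.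
have [u1|u1] := leP `|u| 1.
  by apply: (@le_trans _ _ 1); rewrite ?exprn_ile1 // lerDl exprn_ge0.
apply: (@le_trans _ _ (`|u| ^+ m.*2)); last by rewrite lerDr.
by rewrite ler_weXn2l // ltW.
Qed.

(** * Correlation of a bounded weight with random parities *)

Definition signbit (R : pzRingType) (n : nat) (x : n.-tuple bool) (i : 'I_n) : R :=
  (-1) ^+ tnth x i.

Lemma sign_Xor (R : comPzRingType) (n k : nat) (x : n.-tuple bool) (a : dtuple n k) :
  (-1) ^+ Xor (restrict x a) = \prod_(j < k) signbit R n x (tnth (val a) j).
Proof.
rewrite /Xor signr_odd expr_sum; apply: eq_bigr => j _.
by rewrite tnth_mktuple.
Qed.

Lemma signbit_sqr (R : pzRingType) (n : nat) (x : n.-tuple bool) (i : 'I_n) :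
  signbit R n x i ^+ 2 = 1.
Proof. by rewrite /signbit sqrr_sign. Qed.

(** Expand the square and sum over [t] first. Since [t] ranges over all functions, repetitions
    included, the sum of products factors into a [k]-th power. *)
Lemma sum_sqr_corr (R : comPzRingType) (n k : nat) (mu : n.-tuple bool -> R) :
  \sum_(t : {ffun 'I_k -> 'I_n})
     (\sum_x mu x * \prod_(j < k) signbit R n x (t j)) ^+ 2 =
  \sum_x \sum_y mu x * mu y *
     (\sum_(i < n) signbit R n x i * signbit R n y i) ^+ k.
Proof.
under eq_bigr => t _.
  rewrite expr2 mulr_suml.
  under eq_bigr => x _ do rewrite mulr_sumr.
  over.
rewrite exchange_big; apply: eq_bigr => x _.
rewrite exchange_big; apply: eq_bigr => y _ /=.
rewrite -[in RHS](card_ord k) -prodr_const bigA_distr_bigA /= mulr_sumr.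
apply: eq_bigr => t _; rewrite big_split /=; ring.
Qed.

Lemma moment_corr (R : realFieldType) (n k r : nat) (tau : R)
    (mu : n.-tuple bool -> R) : (k <= r.*2)%N -> 0 < tau ->
  tau ^+ 2 = (8 * r * n)%:R ->
  (forall x, 0 <= mu x <= (2 ^+ n)^-1) ->
  \sum_x \sum_y mu x * mu y *
     (\sum_(i < n) signbit R n x i * signbit R n y i) ^+ k <=
  tau ^+ k * ((\sum_x mu x) ^+ 2 + (\sum_x mu x) * (4 ^+ r)^-1).
Proof.
move=> lekr tau0 tau2 mu_bd.
have mu0 x : 0 <= mu x by have /andP[] := mu_bd x.
pose T x y := \sum_(i < n) signbit R n x i * signbit R n y i.
apply: (@le_trans _ _ (\sum_x \sum_y mu x * mu y *
   (tau ^+ k * (1 + (T x y / tau) ^+ r.*2)))).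
  apply: ler_sum => x _; apply: ler_sum => y _.
  apply: ler_wpM2l; first exact: mulr_ge0.
  rewrite -[X in X ^+ k](divfK (lt0r_neq0 tau0)) exprMn mulrC.
  by rewrite ler_wpM2l ?exprn_le1D // exprn_ge0 // ltW.
have -> : \sum_x \sum_y mu x * mu y * (tau ^+ k * (1 + (T x y / tau) ^+ r.*2)) =
  tau ^+ k * ((\sum_x mu x) ^+ 2 +
    \sum_x mu x * \sum_y mu y * (T x y / tau) ^+ r.*2).
  rewrite expr2 mulr_suml -big_split /= mulr_sumr; apply: eq_bigr => x _.
  rewrite mulr_sumr mulr_sumr -big_split /= mulr_sumr; apply: eq_bigr => y _.
  ring.
apply: ler_wpM2l; first by rewrite exprn_ge0 // ltW.
rewrite lerD2l mulr_suml.
apply: ler_sum => x _; rewrite ler_wpM2l //.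
(* The power of [T] is even, hence nonnegative, so [mu y] may be replaced by its upper bound,
   leaving a uniform average. *)
apply: (@le_trans _ _ (\sum_y (2 ^+ n)^-1 * (T x y ^+ r.*2 / tau ^+ r.*2))).
  apply: ler_sum => y _; rewrite expr_div_n ler_wpM2r //; last first.
    by have /andP[] := mu_bd y.
  by rewrite -!mul2n !exprM divr_ge0 // exprn_ge0 // sqr_ge0.
rewrite -mulr_sumr -mulr_suml mulrC ler_pdivrMr ?exprn_gt0 //.
rewrite ler_pdivrMr ?exprn_gt0 //.
apply: le_trans (@rademacher_moment R n r _ (signbit_sqr R n x)) _.
rewrite -(mul2n r) (exprM tau) tau2.
(* The factor 4 between [tau ^+ 2] and the base 2rn of the moment bound produces the gain 4^-r. *)
have -> : (8 * r * n)%:R = 4 * (2 * r * n)%:R :> R.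
  by rewrite !natrM; ring.
by rewrite exprMn mulrACA mulVf ?expf_neq0 ?pnatr_eq0 // mul1r.
Qed.

Lemma parity_corr_le (R : realFieldType) (n k r : nat) (w : R)
    (mu : n.-tuple bool -> R) :
  (0 < n)%N -> (k.*2 <= n)%N -> (k <= r.*2)%N -> 0 < w ->
  w ^+ 4 = (32 * r)%:R / n%:R ->
  (forall x, 0 <= mu x <= (2 ^+ n)^-1) ->
  #|dtuple n k|%:R^-1 *
    \sum_(a : dtuple n k) `|\sum_x mu x * (-1) ^+ Xor (restrict x a)| <=
  w ^+ k * (\sum_x mu x + (4 ^+ r)^-1).
Proof.
move=> n0 le2kn lekr w0 w4 mu_bd.
have mu0 x : 0 <= mu x by have /andP[] := mu_bd x.
have nR0 : 0 < n%:R :> R by rewrite ltr0n.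
set N : R := #|_|%:R; set M := \sum_x mu x; set dl := (4 ^+ r)^-1.
have M0 : 0 <= M by apply: sumr_ge0.
have dl0 : 0 <= dl by rewrite invr_ge0 exprn_ge0.
have leN : n%:R ^+ k <= 2 ^+ k * N.
  by rewrite /N card_dtuple -!natrX -natrM ler_nat expn_le_ffact.
have N0 : 0 < N.
  by rewrite -(@pmulr_rgt0 _ (2 ^+ k)) ?exprn_gt0 // (lt_le_trans _ leN) ?exprn_gt0.
(* Both sides are nonnegative, so their squares are compared; Cauchy-Schwarz over the distinct
   tuples follows. *)
rewrite -(@ler_pXn2r _ 2) ?nnegrE //; last 2 first.
- by rewrite mulr_ge0 ?invr_ge0 ?ler0n // sumr_ge0.
- by rewrite mulr_ge0 ?addr_ge0 // exprn_ge0 // ltW.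
rewrite exprMn.
apply: (@le_trans _ _ (N^-1 * \sum_(a : dtuple n k)
    (\sum_x mu x * (-1) ^+ Xor (restrict x a)) ^+ 2)).
  rewrite expr2 -mulrA ler_pM2l ?invr_gt0 // mulrC ler_pdivrMr // mulrC.
  apply: le_trans (sqr_sum_le _ _ _) _.
  by rewrite ler_pM2l //; apply: ler_sum => a _; rewrite real_normK ?num_real.
pose G (t : {ffun 'I_k -> 'I_n}) := \sum_x mu x * \prod_(j < k) signbit R n x (t j).
(* Distinct tuples embed into all functions, and the added terms are squares. *)
apply: (@le_trans _ _ (N^-1 * \sum_t G t ^+ 2)).
  rewrite ler_pM2l ?invr_gt0 //.
  pose phi (a : dtuple n k) : {ffun 'I_k -> 'I_n} := [ffun j => tnth (val a) j].
  have phi_inj : injective phi.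
    move=> a b /ffunP eqab; apply/val_inj/eq_from_tnth => j.
    by have := eqab j; rewrite !ffunE.
  rewrite (eq_bigr (fun a => G (phi a) ^+ 2)) => [|a _]; last first.
    congr (_ ^+ 2); apply: eq_bigr => x _; rewrite sign_Xor; congr (_ * _).
    by apply: eq_bigr => j _; rewrite ffunE.
  rewrite -(@big_imset _ _ _ _ _ phi predT (fun t => G t ^+ 2)) /=; last first.
    by move=> a b _ _; apply: phi_inj.
  rewrite [leRHS](bigID (mem [set phi x | x in predT])) /= lerDl.
  by apply: sumr_ge0 => t _; apply: sqr_ge0.
rewrite sum_sqr_corr.
(* Chosen so that [tau ^+ 2] = n^2 w^4 / 4 = 8rn, while [tau ^+ k] is (n/2)^k times the square of
   [w ^+ k]; the factor (n/2)^k is absorbed by [N]. *)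
pose tau : R := n%:R * w ^+ 2 / 2.
have tau0 : 0 < tau by rewrite !mulr_gt0 // ?invr_gt0.
have tau2 : tau ^+ 2 = (8 * r * n)%:R.
  have -> : tau ^+ 2 = n%:R ^+ 2 * w ^+ 4 / 4 by rewrite /tau; field.
  by rewrite w4 !natrM; field; exact: lt0r_neq0.
have H := @moment_corr R n k r tau mu lekr tau0 tau2 mu_bd.
apply: (@le_trans _ _ (N^-1 * (tau ^+ k * (M ^+ 2 + M * dl)))).
  by rewrite ler_pM2l ?invr_gt0.
rewrite ler_pdivrMl // [in leRHS]exprMn.
have -> : tau ^+ k = n%:R ^+ k * (2 ^+ k)^-1 * (w ^+ k) ^+ 2.
  by rewrite /tau -exprM mulnC exprM -exprVn -!exprMn; congr (_ ^+ k); ring.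
have H2 : n%:R ^+ k * (2 ^+ k)^-1 <= N.
  by rewrite ler_pdivrMr ?exprn_gt0 // mulrC.
rewrite -[leLHS]mulrA ler_pM //.
- by rewrite mulr_ge0 ?invr_ge0 ?exprn_ge0 ?ler0n.
- by rewrite mulr_ge0 ?sqr_ge0 // addr_ge0 ?sqr_ge0 // mulr_ge0.
- by rewrite ler_wpM2l ?sqr_ge0 // sqrrD; nra.
Qed.

(** * Probabilities under independent draws *)

Section Pr_iid.
Variables (R : realType) (S : finType).
Implicit Types D : S -> R.

Lemma Pr_iid_cons (m : nat) D (E : pred (m.+1.-tuple S)) :
  Pr_iid D E = \sum_u D u * Pr_iid D (fun us : m.-tuple S => E [tuple of u :: us]).
Proof.
rewrite /Pr_iid big_mkcond big_tuple_cons /=; apply: eq_bigr => u _.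
rewrite mulr_sumr [RHS]big_mkcond /=; apply: eq_bigr => us _.
case: ifP => // _; rewrite big_ord_recl; congr (_ * _).
by apply: eq_bigr => i _; rewrite tnthS.
Qed.

Lemma Pr_iid0 D1 D2 (E : pred (0.-tuple S)) : Pr_iid D1 E = Pr_iid D2 E.
Proof. by apply: eq_bigr => u _; rewrite !big_ord0. Qed.

Lemma Pr_iid_predT (m : nat) D : \sum_u D u = 1 ->
  Pr_iid D (fun _ : m.-tuple S => true) = 1.
Proof.
move=> D1; elim: m => [|m IH].
  rewrite /Pr_iid (eq_bigr (fun=> 1)) => [|u _]; last by rewrite big_ord0.
  by rewrite sumr_const card_tuple.
by rewrite Pr_iid_cons -[RHS]D1; apply: eq_bigr => u _; rewrite IH mulr1.
Qed.

Lemma Pr_iid_ge0 (m : nat) D (E : pred (m.-tuple S)) :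
  (forall u, 0 <= D u) -> 0 <= Pr_iid D E.
Proof. by move=> D0; apply: sumr_ge0 => u _; apply: prodr_ge0. Qed.

Lemma Pr_iidC (m : nat) D (E : pred (m.-tuple S)) : \sum_u D u = 1 ->
  Pr_iid D E + Pr_iid D (predC E) = 1.
Proof. by move=> D1; rewrite -(Pr_iid_predT m D D1) [in RHS]/Pr_iid (bigID E). Qed.

Lemma Pr_iid_le (m : nat) D (E F : pred (m.-tuple S)) :
  (forall u, 0 <= D u) -> (forall us, E us -> F us) -> Pr_iid D E <= Pr_iid D F.
Proof.
move=> D0 EF; rewrite /Pr_iid big_mkcond [leRHS]big_mkcond /=.
apply: ler_sum => us _; case: ifP => [/EF -> //|_].
by case: ifP => // _; apply: prodr_ge0.
Qed.

Lemma Pr_iid_le1 (m : nat) D (E : pred (m.-tuple S)) :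
  (forall u, 0 <= D u) -> \sum_u D u = 1 -> Pr_iid D E <= 1.
Proof. by move=> D0 D1; rewrite -(Pr_iid_predT m D D1); apply: Pr_iid_le. Qed.

End Pr_iid.

(** * Hybrid argument over the layers of a branching program *)

Section Hybrid.
Variables (R : realType) (S : finType) (m d : nat) (B : branching_program S m d).

(** A run from [v] that meets no leaf within [j] samples yields [None] and counts as not
    accepting. *)
Definition accept (D : S -> R) (v : B) (j : nat) : R :=
  Pr_iid D (fun us : j.-tuple S => bp_run v us == Some true).

Lemma bp_run_leaf (v : B) (l : bool) (us : seq S) :
  out v = inl l -> bp_run v us = Some l.
Proof. by case: us => [|u us] /= ->. Qed.

Lemma accept_leaf (D : S -> R) (v : B) (l : bool) (j : nat) :
  \sum_u D u = 1 -> out v = inl l -> accept D v j = l%:R.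
Proof.
move=> D1 vl; rewrite /accept /Pr_iid.
under eq_bigl => us do rewrite (bp_run_leaf _ _ _ vl).
case: l vl => _; first exact: Pr_iid_predT.
by rewrite big_pred0_eq.
Qed.

Lemma accept_node (D : S -> R) (v : B) (next : S -> B) (j : nat) :
  out v = inr next -> accept D v j.+1 = \sum_u D u * accept D (next u) j.
Proof.
move=> vn; rewrite /accept Pr_iid_cons; apply: eq_bigr => u _; congr (_ * _).
by apply: eq_bigl => us /=; rewrite vn.
Qed.

Variables (X : finType) (D0 : S -> R) (D : X -> S -> R) (w beta : R).
Hypotheses (D0_ge0 : forall u, 0 <= D0 u) (D0_sum : \sum_u D0 u = 1).
Hypotheses (D_ge0 : forall x u, 0 <= D x u) (D_sum : forall x, \sum_u D x u = 1).

(* [mu v x] is the joint weight of the hidden string [x] and of being at [v]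
   after [i] planted samples. *)
Definition layer_mass (i : nat) (mu : B -> X -> R) :=
  [/\ forall v x, 0 <= mu v x, forall x, \sum_v mu v x <= w &
      forall v x, layer v != i -> mu v x = 0].

(** Isolates what the hybrid argument needs from the samples. In its use, [h v u] is the probability
    of acceptance by null samples after [u] is read at [v]. *)
Hypothesis step : forall i mu (h : B -> S -> R), layer_mass i mu ->
  (forall v u, 0 <= h v u <= 1) ->
  \sum_v \sum_x mu v x * \sum_u (D x u - D0 u) * h v u <= beta.

(* Paths that stop at a leaf lose their mass, which is harmless because null
   and planted samples have the same acceptance probability there. *)
Let edge (v : B) (u : S) (v' : B) : R :=
  (if out v is inr next then next u == v' else false)%:R.

Let push (mu : B -> X -> R) (v' : B) (x : X) : R :=
  \sum_v mu v x * \sum_u D x u * edge v u v'.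

(** For each sample a vertex has at most one successor, one layer further, so the total weight of
    each [x] cannot grow. *)
Lemma layer_mass_push i mu : layer_mass i mu -> layer_mass i.+1 (push mu).
Proof.
move=> [mu0 muw mui]; split.
- move=> v x; apply: sumr_ge0 => v' _; rewrite mulr_ge0 // sumr_ge0 // => u _.
  by rewrite mulr_ge0 ?ler0n.
- move=> x; apply: le_trans (muw x); rewrite exchange_big /=.
  apply: ler_sum => v _; rewrite -mulr_sumr ler_piMr // exchange_big /=.
  rewrite -[leRHS](D_sum x); apply: ler_sum => u _.
  rewrite -mulr_sumr ler_piMr // /edge.
  case: (out v) => [l|next]; first by rewrite big1.
  rewrite (bigD1 (next u)) //= eqxx big1 ?addr0 // => v'.
  by rewrite eq_sym => /negbTE ->.
- move=> v' x lv'; apply: big1 => v _.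
  have [lv|/mui ->] := eqVneq (layer v) i; last by rewrite mul0r.
  rewrite big1 ?mulr0 // => u _; rewrite /edge.
  case vn: (out v) => [l|next]; first by rewrite mulr0.
  case: eqP => [eqv'|]; last by rewrite mulr0.
  by move: lv'; rewrite -eqv' (layer_out vn) lv eqxx.
Qed.

(** Induction on the number [j] of remaining samples, for all masses at once: one sample costs
    [beta], and the rest is the same sum for the pushed mass on layer [i.+1]. *)
Lemma hybrid_bound j i mu : layer_mass i mu ->
  \sum_v \sum_x mu v x * (accept (D x) v j - accept D0 v j) <= j%:R * beta.
Proof.
elim: j i mu => [|j IH] i mu mui.
  rewrite mul0r big1 // => v _; apply: big1 => x _.
  by rewrite /accept (Pr_iid0 _ _ (D x) D0) subrr mulr0.
(* At a leaf any value in [0,1] would do, because the acceptance difference vanishes there; 0 is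
   taken. *)
pose h v u : R := if out v is inr next then accept D0 (next u) j else 0.
have h01 v u : 0 <= h v u <= 1.
  rewrite /h; case: (out v) => [l|next]; first by rewrite lexx ler01.
  by rewrite Pr_iid_ge0 //= Pr_iid_le1.
(* Telescoping of a node: p a - q b = p (a - b) + (p - q) b, with p planted, q null, and a, b the
   acceptance probabilities after the sample. *)
pose g v' x := accept (D x) v' j - accept D0 v' j.
have split_step v x : accept (D x) v j.+1 - accept D0 v j.+1 =
    \sum_u D x u * (\sum_v' edge v u v' * g v' x) +
    \sum_u (D x u - D0 u) * h v u.
  rewrite /h /edge; case vn: (out v) => [l|next].
    rewrite !(accept_leaf _ _ _ _ _ vn) // subrr.
    rewrite [X in _ = X + _]big1 ?add0r => [|u _]; last first.
      by rewrite big1 ?mulr0 // => v' _; rewrite mul0r.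
    by rewrite big1 // => u _; rewrite mulr0.
  rewrite !(accept_node _ _ _ _ vn) -sumrB -big_split /=; apply: eq_bigr => u _.
  rewrite (bigD1 (next u)) //= eqxx mul1r big1 ?addr0; last first.
    by move=> v'; rewrite eq_sym => /negbTE ->; rewrite mul0r.
  by rewrite /g; ring.
have pushE : \sum_v \sum_x mu v x *
      (\sum_u D x u * (\sum_v' edge v u v' * g v' x)) =
    \sum_v' \sum_x push mu v' x * g v' x.
  rewrite exchange_big [RHS]exchange_big; apply: eq_bigr => x _ /=.
  under [RHS]eq_bigr => v' _ do rewrite /push mulr_suml.
  rewrite exchange_big; apply: eq_bigr => v _ /=.
  under [RHS]eq_bigr => v' _ do rewrite -mulrA mulr_suml.
  rewrite -mulr_sumr exchange_big /=; congr (_ * _).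
  apply: eq_bigr => u _; rewrite mulr_sumr; apply: eq_bigr => v' _.
  by rewrite mulrA.
under eq_bigr => v _.
  under eq_bigr => x _ do rewrite split_step mulrDr.
  rewrite big_split /=; over.
rewrite big_split /= pushE -natr1 mulrDl mul1r.
by apply: lerD; [exact: IH (layer_mass_push _ _ mui)|exact: step mui h01].
Qed.

End Hybrid.

(** * Exchanging one parity sample, and the resulting success probability *)

Lemma big_sample (R : nmodType) (n k : nat) (f : sample n k -> R) :
  \sum_u f u = \sum_(a : dtuple n k) (f (a, true) + f (a, false)).
Proof.
rewrite (eq_bigr (fun u => f (u.1, u.2))) => [|[a b] _ //].
rewrite -(pair_bigA _ (fun a b => f (a, b))) /=.
by apply: eq_bigr => a _; rewrite big_bool.
Qed.

Section Parity.
Variables (R : realType) (n k : nat).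
Local Notation A := (#|dtuple n k|%:R : R).
Hypothesis A_gt0 : 0 < A.

Lemma sum_D_null : \sum_u @D_null R n k u = 1.
Proof.
have cardS : #|sample n k| = (#|dtuple n k| * 2)%N by rewrite card_prod card_bool.
rewrite /D_null sumr_const cardS -[LHS]mulr_natr natrM.
by field; exact: lt0r_neq0.
Qed.

Lemma sum_D_planted (P : k.-tuple bool -> bool) (x : n.-tuple bool) :
  \sum_u D_planted R P x u = 1.
Proof.
rewrite big_sample /D_planted /=.
rewrite (eq_bigr (fun=> A^-1)) => [|a _]; last first.
  by case: (P _); rewrite mulr1 mulr0 ?addr0 ?add0r.
by rewrite sumr_const -[LHS]mulr_natr mulVf ?lt0r_neq0.
Qed.

(** The indicator of b = p is (1 + (-1)^b (-1)^p) / 2, and the null mass is its constant part. *)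
Lemma planted_sub_null (x : n.-tuple bool) (u : sample n k) :
  D_planted R (@Xor k) x u - D_null R u =
  A^-1 / 2 * ((-1) ^+ u.2 * (-1) ^+ Xor (restrict x u.1)).
Proof.
rewrite /D_planted /D_null; case: u => a b /=.
by case: (Xor _); case: b => /=; rewrite ?expr0 ?expr1; lra.
Qed.

(** Summing over the bit leaves the coefficient [h (a, false) - h (a, true)], which lies in
    [-1,1]. *)
Lemma step_advantage (mu : n.-tuple bool -> R) (h : sample n k -> R) :
  (forall u, 0 <= h u <= 1) ->
  \sum_x mu x * \sum_u (D_planted R (@Xor k) x u - D_null R u) * h u <=
  2^-1 * (A^-1 * \sum_(a : dtuple n k)
    `|\sum_x mu x * (-1) ^+ Xor (restrict x a)|).
Proof.
move=> h01; pose F a := \sum_x mu x * (-1) ^+ Xor (@restrict n k x a).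
have -> : \sum_x mu x * \sum_u (D_planted R (@Xor k) x u - D_null R u) * h u =
    A^-1 / 2 * \sum_a (h (a, false) - h (a, true)) * F a.
  under eq_bigr => x _ do rewrite mulr_sumr.
  rewrite exchange_big /= mulr_sumr.
  rewrite big_sample; apply: eq_bigr => a _.
  rewrite -big_split /= !mulr_sumr.
  by apply: eq_bigr => x _; rewrite !planted_sub_null /= expr0 expr1; ring.
rewrite mulrA [2^-1 * _]mulrC ler_pM2l ?divr_gt0 ?invr_gt0 //.
apply: ler_sum => a _; apply: le_trans (ler_norm _) _.
rewrite normrM ler_piMl // ler_norml.
by have := h01 (a, false); have := h01 (a, true); lra.
Qed.

End Parity.

Lemma success_prob_le (R : realType) (n k m d r : nat) (w : R)
    (B : branching_program (sample n k) m d) :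
  (0 < n)%N -> (k.*2 <= n)%N -> (k <= r.*2)%N -> (d <= 4 ^ r)%N -> 0 < w ->
  w ^+ 4 = (32 * r)%:R / n%:R ->
  success_prob R (@Xor k) B <= 1 / 2 + m%:R * w ^+ k / 2.
Proof.
move=> n0 le2kn lekr led w0 w4.
have A0 : 0 < #|dtuple n k|%:R :> R.
  rewrite ltr0n card_dtuple ffact_gt0; apply: leq_trans le2kn.
  by rewrite -addnn leq_addr.
have D0_ge0 u : 0 <= @D_null R n k u by rewrite /D_null mulr_ge0 ?invr_ge0 // ltW.
have D_ge0 (x : n.-tuple bool) u : 0 <= D_planted R (@Xor k) x u.
  by rewrite /D_planted mulr_ge0 ?invr_ge0 ?ler0n.
have wk0 : 0 <= w ^+ k by rewrite exprn_ge0 // ltW.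
have step i mu (h : B -> sample n k -> R) :
    layer_mass R _ _ _ B _ (2 ^+ n)^-1 i mu -> (forall v u, 0 <= h v u <= 1) ->
  \sum_v \sum_x mu v x * \sum_u (D_planted R (@Xor k) x u - D_null R u) * h v u
    <= w ^+ k.
  move=> [mu0 muw mui] h01.
  have mu_bd v x : 0 <= mu v x <= (2 ^+ n)^-1.
    rewrite mu0 (le_trans _ (muw x)) // (bigD1 v) //= lerDl.
    by apply: sumr_ge0.
  rewrite (bigID (fun v => layer v == i)) /= [X in _ + X]big1 ?addr0; last first.
    by move=> v lv; apply: big1 => x _; rewrite mui // mul0r.
  apply: (@le_trans _ _ (\sum_(v | layer v == i)
      2^-1 * (w ^+ k * (\sum_x mu v x + (4 ^+ r)^-1)))).
    apply: ler_sum => v _; apply: le_trans (step_advantage _ _ _ A0 _ _ (h01 v)) _.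
    by rewrite ler_pM2l ?invr_gt0 //; apply: parity_corr_le.
  rewrite -!mulr_sumr big_split /= sumr_const.
  rewrite mulrCA ler_piMr // -ler_pdivlMl ?invr_gt0 // invrK mulr1.
  (* The masses in a layer sum to at most 1, and at most [d] <= 4^r vertices contribute 4^-r each;
     the total 2 cancels the factor 1/2. *)
  rewrite -[2]/(1 + 1); apply: lerD.
    apply: (@le_trans _ _ (\sum_v \sum_x mu v x)).
      rewrite [leRHS](bigID (fun v => layer v == i)) /= lerDl.
      by apply: sumr_ge0 => v _; apply: sumr_ge0.
    rewrite exchange_big /=.
    apply: (@le_trans _ _ (\sum_(x : n.-tuple bool) (2 ^+ n)^-1)).
      by apply: ler_sum.
    rewrite sumr_const card_tuple card_bool -[leLHS]mulr_natr natrX mulVf //.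
    by rewrite expf_neq0 // pnatr_eq0.
  rewrite -[leLHS]mulr_natl ler_pdivrMr ?exprn_gt0 // mul1r -natrX ler_nat.
  apply: leq_trans led; apply: leq_trans (width_max B i).
  by rewrite cardsE.
(* Before any sample, [x] is uniform and all weight sits at the start vertex. *)
pose mu (v : B) (x : n.-tuple bool) : R := (v == start B)%:R * (2 ^+ n)^-1.
have mu_mass : layer_mass R _ _ _ B _ (2 ^+ n)^-1 0 mu.
  split=> [v x|x|v x lv].
  - by rewrite mulr_ge0 ?invr_ge0 ?exprn_ge0 ?ler0n.
  - rewrite (bigD1 (start B)) //= big1 /mu ?eqxx ?mul1r ?addr0 // => v /negbTE ->.
    by rewrite mul0r.
  - rewrite /mu; case: eqP => [vs|]; last by rewrite mul0r.
    by move: lv; rewrite (proj2 (layer_start v) vs).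
have := hybrid_bound R _ _ _ B _ _ _ _ _ D0_ge0 (sum_D_null R n k A0) D_ge0
  (sum_D_planted R n k A0 (@Xor k)) step m 0 mu mu_mass.
rewrite (bigD1 (start B)) //= [X in _ + X]big1 ?addr0; last first.
  by move=> v /negbTE vs; apply: big1 => x _; rewrite /mu vs !mul0r.
under eq_bigr => x _ do rewrite /mu eqxx mul1r.
rewrite -mulr_sumr sumrB sumr_const card_tuple card_bool mulrBr -[X in _ - _ * X]mulr_natl natrX.
rewrite mulrA mulVf ?expf_neq0 ?pnatr_eq0 // mul1r => adv.
(* Output null excludes output planted, so both terms of the success probability become acceptance
   probabilities. *)
have null_le : Pr_iid (@D_null R n k)
    (fun u : m.-tuple _ => bp_output B u == Some false) <=
    1 - accept R _ _ _ B (@D_null R n k) (start B) m.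
  rewrite /accept -(@Pr_iidC R _ m (@D_null R n k)
    (fun us => bp_run (start B) us == Some true)) ?sum_D_null //.
  rewrite addrAC subrr add0r; apply: Pr_iid_le => // us /=.
  by rewrite /bp_output => /eqP ->.
rewrite /success_prob.
have -> : \sum_x Pr_iid (D_planted R (@Xor k) x)
    (fun u : m.-tuple _ => bp_output B u == Some true) =
  \sum_x accept R _ _ _ B (D_planted R (@Xor k) x) (start B) m by [].
by move: adv null_le; lra.
Qed.

(** * Choice of parameters and conclusion *)

(* Here 2304 = 48^2. *)
Lemma powR_bias_bound (R : realType) (n k eps : R) :
  1 <= k -> 2304 * k <= n -> 0 < eps < 1 -> 2304 <= n `^ (1 - eps) ->
  48 * Num.max (n `^ eps) k / n <= (n / k) `^ (- (4 * (1 - eps) / 9)).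
Proof.
move=> k1 lekn /andP[eps0 eps1] ne.
have k0 : 0 < k by lra.
have n0 : 0 < n by lra.
set e := 1 - eps; have e0 : 0 < e by rewrite /e; lra.
have an : 2304 <= n / k by rewrite ler_pdivlMr.
have a0 : 0 < n / k by rewrite divr_gt0.
(* Half of the exponent is spent on absorbing the constant 48. *)
have sqrt_bd (x : R) : 0 < x -> 2304 <= x -> 48 / x <= (x `^ 2^-1)^-1.
  move=> x0 lex; set b := x `^ 2^-1.
  have b0 : 0 < b by rewrite powR_gt0.
  have bb : x = b * b.
    rewrite /b -powRD; last by rewrite (gt_eqF x0) implybT.
    by rewrite -[2^-1]mul1r -splitr powRr1 // ltW.
  have b48 : 48 <= b by rewrite leNgt; apply/negP => ?; nra.
  by rewrite bb invfM mulrA ler_piMl ?invr_ge0 ?(ltW b0) // ler_pdivrMr // mul1r.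
rewrite maxEle; case: ifP => _.
  (* Here the maximum is [k], and 4(1-eps)/9 < 1/2 weakens the exponent. *)
  apply: (@le_trans _ _ ((n / k) `^ (- 2^-1))).
    have -> : 48 * k / n = 48 / (n / k) by rewrite invf_div mulrA.
    by rewrite powRN sqrt_bd.
  apply: ler_powR; first by lra.
  by rewrite /e; lra.
(* Here the maximum is n^eps: e/2 is weakened to 4e/9, then [n] is lowered to n/k. *)
apply: (@le_trans _ _ (n `^ (- (4 * e / 9)))).
  have -> : 48 * n `^ eps / n = 48 / n `^ e.
    rewrite /e powRB ?(gt_eqF n0) ?implybT // powRr1 ?(ltW n0) // invf_div.
    by rewrite mulrA.
  apply: le_trans (sqrt_bd _ _ ne) _; first exact: powR_gt0.
  rewrite -powRrM -powRN; apply: ler_powR; first by lra.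
  by rewrite /e; lra.
rewrite !powRN lef_pV2 ?posrE ?powR_gt0 //.
apply: ge0_ler_powR; rewrite ?nnegrE ?(ltW a0) ?(ltW n0) //.
  by rewrite divr_ge0 // mulr_ge0 // ltW.
by rewrite ler_pdivrMr // ler_peMr // ltW.
Qed.

Lemma lt_memory (R : realType) (d r : nat) : memory R d < r.*2%:R ->
  (d <= 4 ^ r)%N.
Proof.
case: d => // d; rewrite /memory /log2 => ltdr.
have ln2 : 0 < ln 2 :> R by rewrite ln_gt0 // ltr1n.
rewrite -(ler_nat R) -ler_ln ?posrE ?ltr0n ?expn_gt0 //.
rewrite (_ : 4 ^ r = 2 ^ r.*2)%N; last by rewrite -mul2n expnM.
by rewrite natrX lnXn // -[leRHS]mulr_natl -ler_pdivrMr // ltW.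
Qed.

Lemma lt_powR_log2 (R : realType) (n b e : R) (j : nat) :
  1 < n -> 0 < b -> e < 1 - j%:R * (log2 b / log2 n) -> b ^+ j < n `^ (1 - e).
Proof.
move=> n1 b0 lte.
have lnn : 0 < ln n by rewrite ln_gt0.
have ln2 : 0 < ln 2 :> R by rewrite ln_gt0 // ltr1n.
have n0 : 0 < n by lra.
rewrite -ltr_ln ?posrE ?exprn_gt0 ?powR_gt0 // lnXn // ln_powR -[ltLHS]mulr_natl.
rewrite -ltr_pdivrMr // -mulrA.
suff -> : ln b / ln n = log2 b / log2 n by lra.
by rewrite /log2; field; rewrite !lt0r_neq0.
Qed.

Theorem theorem5p2 (R : realType) :
  exists c : R, 0 < c /\
  forall (n k m d : nat) (eps s : R)
         (B : branching_program (sample n k) m d),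
    (0 < k)%N ->
    0 < eps ->
    eps < 1 - 3 * (log2 24 / log2 n%:R) ->
    memory R d < n%:R `^ eps ->
    1 / 2 + s <= success_prob R (@Xor k) B ->
    k%:R <= n%:R / c ->
    3 * (n%:R / k%:R) `^ (- ((1 - eps) / 18 * k%:R)) < s ->
    (n%:R / k%:R) `^ ((1 - eps) / 18 * k%:R) <= m%:R.
Proof.
exists 2304; split=> // n k m d eps s B k0 eps0 lteps mem succ.
rewrite ler_pdivlMr // mulrC => lekn lts.
have k1 : 1 <= k%:R :> R by rewrite ler1n.
have nR0 : 0 < n%:R :> R by lra.
have n0 : (0 < n)%N by rewrite -(ltr0n R).
have nR1 : 1 < n%:R :> R by lra.
(* This gives 24^3 < n^(1-eps), and 24^3 = 13824 exceeds the 2304 required by [powR_bias_bound]. *)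
have powe := lt_powR_log2 _ _ _ _ 3 nR1 (ltr0n R 24) lteps.
have eps1 : eps < 1.
  rewrite ltNge; apply/negP => leps.
  have : n%:R `^ (1 - eps) <= n%:R `^ 0 :> R.
    by apply: ler_powR; [exact: ltW | lra].
  by rewrite powRr0; lra.
pose z : R := Num.max (n%:R `^ eps) k%:R.
have zk : k%:R <= z by rewrite le_max lexx orbT.
have ze : n%:R `^ eps <= z by rewrite le_max lexx.
(* The successor makes 2r > z, so 2r exceeds both [k] and the memory. As z >= 1, also 32r <= 16z +
   32 <= 48z, the source of 48. *)
pose r := (Num.truncn (z / 2)).+1.
have /andP[lez ltz] : (Num.truncn (z / 2))%:R <= z / 2 < r%:R.
  by apply: truncn_itv; lra.
have r2 : r.*2%:R = 2 * r%:R :> R by rewrite -mul2n natrM.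
have rz : r%:R <= z / 2 + 1 by rewrite /r -natr1 lerD2r.
have lekr : (k <= r.*2)%N by rewrite -(ler_nat R) r2; lra.
have led : (d <= 4 ^ r)%N by apply: (@lt_memory R); rewrite r2; lra.
have le2kn : (k.*2 <= n)%N by rewrite -(ler_nat R) -mul2n natrM; lra.
have rn0 : 0 < (32 * r)%:R / n%:R :> R by rewrite divr_gt0 // ltr0n.
pose w : R := Num.sqrt (Num.sqrt ((32 * r)%:R / n%:R)).
have w0 : 0 < w by rewrite !sqrtr_gt0.
have w4 : w ^+ 4 = (32 * r)%:R / n%:R.
  by rewrite (exprM _ 2 2) !sqr_sqrtr // ?sqrtr_ge0 // ltW.
have := success_prob_le R n k m d r w B n0 le2kn lekr led w0 w4.
move/(le_trans succ) => {succ} les.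
set a : R := n%:R / k%:R in lts *.
have a0 : 0 < a by rewrite divr_gt0 //; lra.
have lew : w <= a `^ (- ((1 - eps) / 9)).
  rewrite -(@ler_pXn2r _ 4) ?nnegrE ?powR_ge0 ?(ltW w0) // w4.
  rewrite -powR_mulrn ?powR_ge0 // -powRrM.
  have -> : - ((1 - eps) / 9) * 4%:R = - (4 * (1 - eps) / 9) by ring.
  apply: (le_trans _ (powR_bias_bound R n%:R k%:R eps k1 lekn _ _)); last 2 first.
  - by rewrite eps0.
  - by apply: le_trans (ltW powe); lra.
  by rewrite ler_pM2r ?invr_gt0 // -/z natrM; lra.
rewrite leNgt; apply/negP => ltm.
set N := a `^ _ in ltm.
(* With [w ^+ k] <= N^-2, having m < N would give s <= N^-1 / 2, against s > 3 N^-1. *)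
have N0 : 0 < N by rewrite powR_gt0.
have lewk : w ^+ k <= N^-1 * N^-1.
  apply: (@le_trans _ _ ((a `^ (- ((1 - eps) / 9))) ^+ k)).
    by rewrite lerXn2r ?nnegrE ?powR_ge0 // ltW.
  rewrite -powR_mulrn ?powR_ge0 // -powRrM -powRN -powRD ?(gt_eqF a0) ?implybT //.
  by rewrite le_eqVlt; apply/orP; left; apply/eqP; congr (_ `^ _); field.
have : m%:R * w ^+ k <= N * (N^-1 * N^-1).
  by apply: ler_pM => //; [exact: exprn_ge0 (ltW w0) | exact: ltW].
rewrite mulrA divff ?lt0r_neq0 // mul1r.
move: lts; rewrite powRN -/N.
have : 0 < N^-1 by rewrite invr_gt0.
lra.
Qed.
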